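(* Let $\geq$ be the relation on the set of acts $X^S$ defined by $f\geq g\Leftrightarrow N([f\geq g])\geq N([g\geq f])$, where $N$ is a necessity function on $2^S$. Then $\geq$ obeys the sure thing principle: for all $A\subseteq S$ and all acts $f,g,h,h'$, $$f_{|A}\cup h_{|\bar A}\ \geq\ g_{|A}\cup h_{|\bar A}\iff f_{|A}\cup h'_{|\bar A}\ \geq\ g_{|A}\cup h'_{|\bar A}.$$
   Context: $S$ is a finite set of states; $X$ is a set of consequences with a total preorder $\geq_P$ (complete, transitive) having at least two elements $x,y$ with $x>_P y$. An act is a map $f:S\to X$. For acts $f,g$: $[f\geq g]=\{s\in S:f(s)\geq_P g(s)\}$. A necessity function is a map $N:2^S\to[0,1]$ with $N(F\cap G)=\min(N(F),N(G))$ for all $F,G\subseteq S$ and $N(S)>N(\emptyset)$. For $A\subseteq S$, $\bar A=S\setminus A$, and $f_{|A}\cup g_{|\bar A}$ is the act equal to $f(s)$ if $s\in A$ and to $g(s)$ otherwise. *)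

(* Defs.v *)
From mathcomp Require Import all_boot all_order all_algebra.
From mathcomp Require Import reals.

Set Implicit Arguments.
Unset Strict Implicit.
Unset Printing Implicit Defensive.

Import Order.TTheory GRing.Theory Num.Theory.
Local Open Scope ring_scope.

(* [geP x y] reads "x is at least as preferred as y". *)
Definition gtP (X : Type) (geP : rel X) : rel X :=
  fun x y => geP x y && ~~ geP y x.

Definition act (S : finType) (X : Type) : Type := S -> X.

Definition ge_event (S : finType) (X : Type) (geP : rel X) (f g : act S X) :
  {set S} := [set s | geP (f s) (g s)].

Definition mix (S : finType) (X : Type) (A : {set S}) (f g : act S X) :
  act S X := fun s => if s \in A then f s else g s.

Definition necessity (R : realType) (S : finType) (N : {set S} -> R) : Prop :=
  [/\ forall F : {set S}, 0 <= N F <= 1,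
      forall F G : {set S}, N (F :&: G) = Num.min (N F) (N G)
    & N set0 < N [set: S]].

Definition lifted_ge (R : realType) (S : finType) (X : Type) (geP : rel X)
  (N : {set S} -> R) : rel (act S X) :=
  fun f g => N (ge_event geP f g) >= N (ge_event geP g f).

Definition sure_thing_principle (S : finType) (X : Type)
  (ge : rel (act S X)) : Prop :=
  forall (A : {set S}) (f g h h' : act S X),
    ge (mix A f h) (mix A g h) <-> ge (mix A f h') (mix A g h').

(* Main.v *)
Require Import Defs.
From mathcomp Require Import all_boot all_order all_algebra.
From mathcomp Require Import reals.

(** Outside [A] the two mixed acts coincide, so by reflexivity of [geP] every state of [~: A]
    belongs to both preference events, whatever the common part [h] is. The events compared by [N]
    therefore depend only on [f], [g] and [A]. *)

Lemma ge_event_mix (S : finType) (X : Type) (geP : rel X)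
    (A : {set S}) (f g h : act S X) :
  reflexive geP ->
  ge_event geP (mix A f h) (mix A g h) = ge_event geP f g :|: ~: A.
Proof.
move=> geP_refl; apply/setP => s; rewrite !inE /mix.
by case: (s \in A); rewrite /= ?orbF ?orbT ?geP_refl.
Qed.

Theorem mainTheorem3 (R : realType) (S : finType) (X : Type) (geP : rel X)
    (geP_total : total geP) (geP_trans : transitive geP)
    (geP_nontrivial : exists x y : X, gtP geP x y)
    (N : {set S} -> R) (N_necessity : necessity N) :
  sure_thing_principle (lifted_ge geP N).
Proof.
have geP_refl : reflexive geP by move=> x; have := geP_total x x; rewrite orbb.
(* With [h] and [h'] gone from all four events, both sides of the equivalence are the same
   inequality. *)
by move=> A f g h h'; rewrite /lifted_ge !ge_event_mix.
Qed.
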